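(* Let $\mathcal J\in\operatorname{Aut}_{\mathbb R}(TM\oplus T^*M)$ be a generalized almost complex structure on a real manifold $M$, and let $S\subset M$ be a split submanifold, so that $TM|_S=TS\oplus N$ for some smooth subbundle $N\subseteq TM|_S$ such that $TS\oplus\operatorname{Ann}(N)$ is stable under $\mathcal J$. Equip $S$ with the induced generalized almost complex structure $E_S$. Let $\pi:T_{\mathbb C}M|_S\to T_{\mathbb C}S$ denote the projection parallel to $N_{\mathbb C}$. For every open subset $U\subseteq M$, the map $$\Gamma(U,C^\infty_M\oplus T_{\mathbb C}M)\longrightarrow\Gamma(U\cap S,C^\infty_S\oplus T_{\mathbb C}S),\qquad (f,X)\mapsto\bigl(f|_S,\pi(X|_S)\bigr),$$ induces a ring homomorphism from $\mathcal{COU}_M(U)$ to $\mathcal{COU}_S(U\cap S)$. In particular, the restriction of an admissible function to a split submanifold is always admissible.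
   Context: Manifolds are $C^\infty$, real, finite-dimensional; $T_{\mathbb C}M$, $T^*_{\mathbb C}M$ are the complexified tangent and cotangent bundles, and $C^\infty_M$ is the sheaf of complex-valued smooth functions. The pairing on $TM\oplus T^*M$ and its complexification is $\langle X+\xi,Y+\eta\rangle=-\tfrac12(\xi(Y)+\eta(X))$. A generalized almost complex structure (GACS) on $M$ is an $\mathbb R$-linear bundle automorphism $\mathcal J$ of $TM\oplus T^*M$, orthogonal for this pairing, with $\mathcal J^2=-1$; equivalently a smooth maximally isotropic complex subbundle $E\subset T_{\mathbb C}M\oplus T^*_{\mathbb C}M$ with $E\cap\overline E=0$, where $E$ is the $+i$-eigenbundle of $\mathcal J$. A smooth submanifold $S$ of $M$ is split if there is a smooth subbundle $N$ of $TM|_S$ with $TM|_S=TS\oplus N$ and $TS\oplus\operatorname{Ann}(N)\subseteq(TM\oplus T^*M)|_S$ invariant under $\mathcal J$. ($\operatorname{Ann}(N)\subseteq T^*M|_S$ is the annihilator.) For such $S$, the pointwise-defined $E_S=\{(w,\xi|_{T_{\mathbb C}S}):(w,\xi)\in E|_S,\ w\in T_{\mathbb C}S\}$ is a smooth subbundle of $T_{\mathbb C}S\oplus T^*_{\mathbb C}S$ defining a GACS on $S$, the induced GACS. The Courant sheaf of a manifold $M$ with GACS $E$ is the subsheaf $\mathcal{COU}_M$ of $C^\infty_M\oplus T_{\mathbb C}M$ with $\mathcal{COU}_M(U)=\{(f,X): df+X\in\Gamma(U,\overline E)\}$; it is a sheaf of commutative unital rings under componentwise addition and the multiplication $(f,X)\cdot(g,Y)=(fg,fY+gX)$.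 $f\in C^\infty_M(U)$ is admissible if there is $X\in\Gamma(U,T_{\mathbb C}M)$ with $(f,X)\in\mathcal{COU}_M(U)$. $\mathcal{COU}_S$ is defined likewise from $E_S$. *)

(* Defs.v *)
From HB Require Import structures.
From mathcomp Require Import all_boot all_order all_algebra.
From mathcomp Require Import complex ring.
From mathcomp Require Import all_classical all_reals all_analysis.

Set Implicit Arguments.
Unset Strict Implicit.
Unset Printing Implicit Defensive.

Import Order.TTheory GRing.Theory Num.Theory.
Import numFieldNormedType.Exports.
Local Open Scope classical_set_scope.
Local Open Scope ring_scope.

(* [Ck k f x]: [f] is of class C^k on a neighbourhood of [x]. *)
Fixpoint Ck (R : realType) (n : nat) (V : normedModType R) (k : nat)
    (f : 'rV[R]_n -> V) (x : 'rV[R]_n) : Prop :=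
  match k with
  | 0 => \forall y \near x, {for y, continuous f}
  | k'.+1 => (\forall y \near x, differentiable f y) /\
             (forall v, Ck k' (fun y => 'D_v f y) x)
  end.

Definition smooth_at (R : realType) (n : nat) (V : normedModType R)
    (f : 'rV[R]_n -> V) (x : 'rV[R]_n) : Prop :=
  forall k, Ck k f x.

Section SmoothRing.
Variables (R : realType) (n : nat).

Lemma near_eq_differentiable (V : normedModType R) (f g : 'rV[R]_n -> V) x :
  (\forall y \near x, f y = g y) -> differentiable f x -> differentiable g x.
Proof.
move=> fg df; rewrite (_ : g = f + (g - f)); last first.
  by apply/funext => y; rewrite !fctE subrKC.
apply: differentiableD => //; set h := g - f.
have h0 : \forall y \near x, h y = 0.
  by near=> y; rewrite /h !fctE (near fg)// subrr.
have dh : h \o shift x = cst (h x) + (\0 : {linear 'rV[R]_n -> V}) +o_ 0 id.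
  apply/eqaddoP => e e0.
  have h0' : \forall y \near (0 : 'rV[R]_n), h (y + x) = 0.
    by move: h0; rewrite (near_shift 0) subr0.
  near=> y.
  rewrite (_ : _ y = h (y + x) - (h x + 0)) // (near h0' y) //.
  by rewrite (nbhs_singleton h0) addr0 subrr normr0 mulr_ge0// ltW.
have c0 : continuous (\0 : {linear 'rV[R]_n -> V}) by exact: cst_continuous.
by apply/diff_locallyP; rewrite (diff_unique c0 dh).
Unshelve. all: by end_near. Qed.

Lemma Ck_near (V : normedModType R) k (f g : 'rV[R]_n -> V) x :
  (\forall y \near x, f y = g y) -> Ck k f x -> Ck k g x.
Proof.
elim: k f g x => [|k IH] f g x fg /=; have nfg := near_join fg.
  move=> cf; near=> y.
  have fgy : \forall z \near y, f z = g z by near: y.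
  have cfy : {for y, continuous f} by near: y.
  rewrite /prop_for /continuous_at -(nbhs_singleton fgy).
  by apply: (cvg_trans _ cfy); exact: near_eq_cvg fgy.
move=> [df Df]; split.
  near=> y.
  have fgy : \forall z \near y, f z = g z by near: y.
  by apply: near_eq_differentiable fgy _; near: y.
move=> v; apply: IH (Df v); near=> y; apply: near_eq_derive.
by near: y.
Unshelve. all: by end_near. Qed.

Lemma Ck_pred (V : normedModType R) k (f : 'rV[R]_n -> V) x :
  Ck k.+1 f x -> Ck k f x.
Proof.
elim: k f x => [|k IH] f x [df Df]; last by split => // v; exact: IH.
by near=> y; apply: differentiable_continuous; near: y.
Unshelve. all: by end_near. Qed.

Lemma smooth_cst (V : normedModType R) (a : V) (x : 'rV[R]_n) :
  smooth_at (fun=> a) x.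
Proof.
move=> k; elim: k a => [|k IH] a /=.
  by near=> y; exact: cst_continuous.
split=> [|v]; first by near=> y; exact: differentiable_cst.
by apply: Ck_near (IH 0); near=> y; rewrite derive_cst.
Unshelve. all: by end_near. Qed.

Lemma CkD (V : normedModType R) k (f g : 'rV[R]_n -> V) x :
  Ck k f x -> Ck k g x -> Ck k (fun y => f y + g y) x.
Proof.
elim: k f g => [|k IH] f g /=.
  move=> cf cg; near=> y.
  have cfy : {for y, continuous f} by near: y.
  have cgy : {for y, continuous g} by near: y.
  exact: (cvgD cfy cgy).
move=> [df Df] [dg Dg]; split.
  by near=> y; apply: differentiableD; near: y.
move=> v; apply: Ck_near (IH _ _ (Df v) (Dg v)).
by near=> y; rewrite -deriveD//; apply: diff_derivable; near: y.
Unshelve. all: by end_near. Qed.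

Lemma CkM k (f g : 'rV[R]_n -> R) x :
  Ck k f x -> Ck k g x -> Ck k (fun y => f y * g y) x.
Proof.
elim: k f g => [|k IH] f g.
  move=> /= cf cg; near=> y.
  have cfy : {for y, continuous f} by near: y.
  have cgy : {for y, continuous g} by near: y.
  exact: (cvgM cfy cgy).
move=> sf sg; have [[df Df] [dg Dg]] := (sf, sg); split.
  by near=> y; apply: differentiableM; near: y.
move=> v; apply: (@Ck_near _ _ (fun y => f y * 'D_v g y + g y * 'D_v f y)).
  by near=> y; rewrite [RHS]deriveM//; apply: diff_derivable; near: y.
have sf' := Ck_pred sf; have sg' := Ck_pred sg.
exact: CkD (IH _ _ sf' (Dg v)) (IH _ _ sg' (Df v)).
Unshelve. all: by end_near. Qed.

Lemma smoothD (V : normedModType R) (f g : 'rV[R]_n -> V) x :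
  smooth_at f x -> smooth_at g x -> smooth_at (fun y => f y + g y) x.
Proof. by move=> sf sg k; exact: CkD. Qed.

Lemma smoothM (f g : 'rV[R]_n -> R) x :
  smooth_at f x -> smooth_at g x -> smooth_at (fun y => f y * g y) x.
Proof. by move=> sf sg k; exact: CkM. Qed.

Lemma smoothN (f : 'rV[R]_n -> R) x :
  smooth_at f x -> smooth_at (fun y => - f y) x.
Proof.
move=> sf k; apply: Ck_near (smoothM (smooth_cst (-1 : R) x) sf k).
by near=> y; rewrite mulN1r.
Unshelve. all: by end_near. Qed.

Lemma smooth_differentiable (V : normedModType R) (f : 'rV[R]_n -> V) x :
  smooth_at f x -> differentiable f x.
Proof. by move=> /(_ 1%N)[/nbhs_singleton]. Qed.

End SmoothRing.

(* A homeomorphism from an open subset of [T] onto an open subset of R^n,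
   given by total functions whose values outside these sets are irrelevant. *)
Record chart (R : realType) (T : topologicalType) (n : nat) := Chart {
  cdom : set T;
  ccod : set 'rV[R]_n;
  cmap :> T -> 'rV[R]_n;
  cinv : 'rV[R]_n -> T;
  cdom_open : open cdom;
  ccod_open : open ccod;
  cmap_cod : forall p, cdom p -> ccod (cmap p);
  cinv_dom : forall x, ccod x -> cdom (cinv x);
  cmapK : forall p, cdom p -> cinv (cmap p) = p;
  cinvK : forall x, ccod x -> cmap (cinv x) = x;
  cmap_cont : forall p, cdom p -> {for p, continuous cmap};
  cinv_cont : forall x, ccod x -> {for x, continuous cinv} }.

(* The atlas determines the smooth structure and need not be maximal.  The
   preferred chart [chart_at p] is only used to name tangent vectors at [p]:
   it identifies T_pM with R^n. *)
Record manifold (R : realType) (T : topologicalType) (n : nat) := Manifold {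
  mfd_hausdorff : hausdorff_space T;
  mfd_countable : @second_countable T;
  atlas : set (chart R T n);
  chart_at : T -> chart R T n;
  chart_at_atlas : forall p, atlas (chart_at p);
  chart_at_dom : forall p, cdom (chart_at p) p;
  atlas_compat : forall phi psi, atlas phi -> atlas psi ->
    forall p, cdom phi p -> cdom psi p ->
    smooth_at (psi \o cinv phi) (phi p) }.

Record opens (T : topologicalType) := Opens {
  oset :> set T;
  oset_open : open oset }.

Definition smooth_map_at (R : realType) (T : topologicalType) (n : nat)
    (A : manifold R T n) (V : normedModType R) (g : T -> V) (p : T) : Prop :=
  forall phi, atlas A phi -> cdom phi p -> smooth_at (g \o cinv phi) (phi p).

Definition csmooth_map_at (R : realType) (T : topologicalType) (n : nat)
    (A : manifold R T n) (f : T -> R[i]) (p : T) : Prop :=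
  smooth_map_at A (fun q => complex.Re (f q) : R) p /\
  smooth_map_at A (fun q => complex.Im (f q) : R) p.

(* Vectors are row vectors and linear maps act on the right.  A tangent vector
   at [p] is its coordinate row in [chart_at A p]; a covector at [p] is its
   coordinate row in the dual basis; [X + xi] is [row_mx X xi]. *)

Definition ev (F : pzRingType) (n : nat) (xi v : 'rV[F]_n) : F :=
  (xi *m v^T) 0 0.

Definition cmx (R : realType) (a b : nat) (B : 'M[R]_(a, b)) : 'M[R[i]]_(a, b) :=
  map_mx (real_complex R) B.

(* The change of coordinates on T_pM from [chart_at A p] to [phi]. *)
Definition dchart (R : realType) (T : topologicalType) (n : nat)
    (A : manifold R T n) (phi : chart R T n) (p : T) : 'M[R]_n :=
  'J (phi \o cinv (chart_at A p)) (chart_at A p p).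

(* The same on T_pM + T*_pM; covectors change by the inverse transpose. *)
Definition gchart (R : realType) (T : topologicalType) (n : nat)
    (A : manifold R T n) (phi : chart R T n) (p : T) : 'M[R]_(n + n) :=
  block_mx (dchart A phi p) 0 0 (invmx (dchart A phi p))^T.

Definition dmap (R : realType) (T T' : topologicalType) (n n' : nat)
    (A : manifold R T n) (A' : manifold R T' n') (h : T -> T') (p : T)
    : 'M[R]_(n, n') :=
  'J (chart_at A' (h p) \o h \o cinv (chart_at A p)) (chart_at A p p).

Definition dfun (R : realType) (T : topologicalType) (n : nat)
    (A : manifold R T n) (f : T -> R[i]) (p : T) : 'rV[R[i]]_n :=
  let phi := chart_at A p in
  \row_j Complex
    ('D_(delta_mx 0 j) (fun x => complex.Re (f (cinv phi x)) : R) (phi p))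
    ('D_(delta_mx 0 j) (fun x => complex.Im (f (cinv phi x)) : R) (phi p)).

Definition csmooth_field_at (R : realType) (T : topologicalType) (n : nat)
    (A : manifold R T n) (X : T -> 'rV[R[i]]_n) (p : T) : Prop :=
  forall phi, atlas A phi -> cdom phi p -> forall j,
  csmooth_map_at A (fun q => (X q *m cmx (dchart A phi q)) 0 j) p.

Definition pairing (R : realType) (n : nat) (u v : 'rV[R]_(n + n)) : R :=
  - 2^-1 * (ev (rsubmx u) (lsubmx v) + ev (rsubmx v) (lsubmx u)).

Record gacs (R : realType) (T : topologicalType) (n : nat)
    (A : manifold R T n) := Gacs {
  gJ :> T -> 'M[R]_(n + n);
  gJ_smooth : forall p phi, atlas A phi -> cdom phi p ->
    smooth_map_at A
      (fun q => invmx (gchart A phi q) *m gJ q *m gchart A phi q) p;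
  gJ_orth : forall p u v, pairing (u *m gJ p) (v *m gJ p) = pairing u v;
  gJ_sq : forall p, gJ p *m gJ p = - 1%:M }.

(* A complex subspace of each fibre of the complexified TM + T*M. *)
Record cfibers (R : realType) (T : Type) (n : nat) := CFibers {
  cfib :> T -> set 'rV[R[i]]_(n + n);
  cfib0 : forall p, cfib p 0;
  cfib_lin : forall p (a : R[i]) e e',
    cfib p e -> cfib p e' -> cfib p (a *: e + e') }.

Section EigenBundle.
Variables (R : realType) (T : topologicalType) (n : nat) (A : manifold R T n).
Variable J : gacs A.

Definition eigen_fib (p : T) : set 'rV[R[i]]_(n + n) :=
  [set e | e *m cmx (J p) = ('i)%C *: e].

Lemma eigen_fib0 p : eigen_fib p 0.
Proof. by rewrite /eigen_fib /= mul0mx scaler0. Qed.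

Lemma eigen_fib_lin p (a : R[i]) e e' :
  eigen_fib p e -> eigen_fib p e' -> eigen_fib p (a *: e + e').
Proof.
rewrite /eigen_fib /= => he he'.
by rewrite mulmxDl -scalemxAl he he' scalerDr !scalerA mulrC.
Qed.

Definition eigenbundle : cfibers R T n := CFibers eigen_fib0 eigen_fib_lin.
End EigenBundle.

Section SmoothComplex.
Variables (R : realType) (T : topologicalType) (n : nat) (A : manifold R T n).
Implicit Types (f g : T -> R[i]) (X Y : T -> 'rV[R[i]]_n) (p : T).

Lemma cinv_near (phi : chart R T n) p (P : set T) : cdom phi p ->
  (\forall q \near p, P q) -> \forall x \near phi p, P (cinv phi x).
Proof.
move=> dp; have := cinv_cont (cmap_cod dp).
by rewrite /prop_for /continuous_at cmapK // => /(_ P).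
Qed.

Lemma smooth_map_near (V : normedModType R) (g h : T -> V) p :
  (\forall q \near p, g q = h q) -> smooth_map_at A g p -> smooth_map_at A h p.
Proof.
move=> gh sg phi aphi dp k; apply: Ck_near (sg _ aphi dp k).
exact: cinv_near gh.
Qed.

Lemma smooth_map_cst (V : normedModType R) (a : V) p :
  smooth_map_at A (fun=> a) p.
Proof. by move=> phi aphi dp; exact: smooth_cst. Qed.

Lemma smooth_mapD (V : normedModType R) (g h : T -> V) p :
  smooth_map_at A g p -> smooth_map_at A h p ->
  smooth_map_at A (fun q => g q + h q) p.
Proof. by move=> sg sh phi aphi dp; apply: smoothD; [exact: sg|exact: sh]. Qed.

Lemma smooth_mapM (g h : T -> R) p :
  smooth_map_at A g p -> smooth_map_at A h p ->
  smooth_map_at A (fun q => g q * h q) p.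
Proof. by move=> sg sh phi aphi dp; apply: smoothM; [exact: sg|exact: sh]. Qed.

Lemma smooth_mapN (g : T -> R) p :
  smooth_map_at A g p -> smooth_map_at A (fun q => - g q) p.
Proof. by move=> sg phi aphi dp; apply: smoothN; exact: sg. Qed.

Lemma csmooth_near f g p :
  (\forall q \near p, f q = g q) -> csmooth_map_at A f p -> csmooth_map_at A g p.
Proof.
move=> fg [rf cf]; split; [apply: smooth_map_near rf|apply: smooth_map_near cf];
  by apply: filterS fg => q ->.
Qed.

Lemma csmooth_cst (a : R[i]) p : csmooth_map_at A (fun=> a) p.
Proof. by split; exact: smooth_map_cst. Qed.

Lemma csmoothD f g p : csmooth_map_at A f p -> csmooth_map_at A g p ->
  csmooth_map_at A (fun q => f q + g q) p.
Proof.
move=> [rf cf] [rg cg]; split.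
- under eq_fun do rewrite raddfD; exact: smooth_mapD.
- under eq_fun do rewrite raddfD; exact: smooth_mapD.
Qed.

Let ReM (x y : R[i]) : complex.Re (x * y) =
  complex.Re x * complex.Re y - complex.Im x * complex.Im y.
Proof. by case: x y => ? ? []. Qed.

Let ImM (x y : R[i]) : complex.Im (x * y) =
  complex.Re x * complex.Im y + complex.Im x * complex.Re y.
Proof. by case: x y => ? ? []. Qed.

Lemma csmoothM f g p : csmooth_map_at A f p -> csmooth_map_at A g p ->
  csmooth_map_at A (fun q => f q * g q) p.
Proof.
move=> [rf cf] [rg cg].
split.
- under eq_fun do rewrite ReM.
  by apply: smooth_mapD; [|apply: smooth_mapN]; exact: smooth_mapM.
- under eq_fun do rewrite ImM.
  by apply: smooth_mapD; exact: smooth_mapM.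
Qed.

Lemma csmooth_field_cst0 p : csmooth_field_at A (fun=> 0) p.
Proof.
move=> phi aphi dp j; under eq_fun do rewrite mul0mx mxE.
exact: csmooth_cst.
Qed.

Lemma csmooth_fieldD X Y p : csmooth_field_at A X p -> csmooth_field_at A Y p ->
  csmooth_field_at A (fun q => X q + Y q) p.
Proof.
move=> sX sY phi aphi dp j; under eq_fun do rewrite mulmxDl mxE.
by apply: csmoothD; [exact: sX|exact: sY].
Qed.

Lemma csmooth_fieldZ f X p : csmooth_map_at A f p -> csmooth_field_at A X p ->
  csmooth_field_at A (fun q => f q *: X q) p.
Proof.
move=> sf sX phi aphi dp j; under eq_fun do rewrite -scalemxAl mxE.
by apply: csmoothM; [exact: sf|exact: sX].
Qed.

Lemma dfun_near f g p :
  (\forall q \near p, f q = g q) -> dfun A f p = dfun A g p.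
Proof.
move=> fg; have := cinv_near (chart_at_dom A p) fg => {}fg.
by apply/rowP => j; rewrite !mxE; congr Complex; apply: near_eq_derive;
  apply: filterS fg => x ->.
Qed.

Lemma dfun_cst (a : R[i]) p : dfun A (fun=> a) p = 0.
Proof. by apply/rowP => j; rewrite !mxE !derive_cst. Qed.

Let smooth_derivable (h : T -> R) p j : smooth_map_at A h p ->
  derivable (fun x => h (cinv (chart_at A p) x)) (chart_at A p p)
    (delta_mx 0 j).
Proof.
move=> /(_ _ (chart_at_atlas A p) (chart_at_dom A p)).
by move=> /smooth_differentiable /diff_derivable.
Qed.

Lemma dfunD f g p : csmooth_map_at A f p -> csmooth_map_at A g p ->
  dfun A (fun q => f q + g q) p = dfun A f p + dfun A g p.
Proof.
move=> [rf cf] [rg cg]; apply/rowP => j; rewrite !mxE.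
have rfj := @smooth_derivable _ _ j rf; have cfj := @smooth_derivable _ _ j cf.
have rgj := @smooth_derivable _ _ j rg; have cgj := @smooth_derivable _ _ j cg.
rewrite (_ : (fun x => complex.Re _) =
  (fun x => complex.Re (f (cinv (chart_at A p) x))) +
  (fun x => complex.Re (g (cinv (chart_at A p) x)))); last first.
  by apply/funext => x; rewrite raddfD.
rewrite (_ : (fun x => complex.Im (_ + _)) =
  (fun x => complex.Im (f (cinv (chart_at A p) x))) +
  (fun x => complex.Im (g (cinv (chart_at A p) x)))); last first.
  by apply/funext => x; rewrite raddfD.
by rewrite (deriveD rfj rgj) (deriveD cfj cgj).
Qed.

Lemma dfunM f g p : csmooth_map_at A f p -> csmooth_map_at A g p ->
  dfun A (fun q => f q * g q) p = f p *: dfun A g p + g p *: dfun A f p.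
Proof.
move=> [rf cf] [rg cg]; apply/rowP => j; rewrite !mxE.
have rfj := @smooth_derivable _ _ j rf; have cfj := @smooth_derivable _ _ j cf.
have rgj := @smooth_derivable _ _ j rg; have cgj := @smooth_derivable _ _ j cg.
rewrite (_ : (fun x => complex.Re _) =
  (fun x => complex.Re (f (cinv (chart_at A p) x))) *
  (fun x => complex.Re (g (cinv (chart_at A p) x))) -
  (fun x => complex.Im (f (cinv (chart_at A p) x))) *
  (fun x => complex.Im (g (cinv (chart_at A p) x)))); last first.
  by apply/funext => x; rewrite ReM.
rewrite (_ : (fun x => complex.Im (_ * _)) =
  (fun x => complex.Re (f (cinv (chart_at A p) x))) *
  (fun x => complex.Im (g (cinv (chart_at A p) x))) +
  (fun x => complex.Im (f (cinv (chart_at A p) x))) *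
  (fun x => complex.Re (g (cinv (chart_at A p) x)))); last first.
  by apply/funext => x; rewrite ImM.
rewrite (deriveB (derivableM rfj rgj) (derivableM cfj cgj)).
rewrite (deriveD (derivableM rfj cgj) (derivableM cfj rgj)).
rewrite (deriveM rfj rgj) (deriveM cfj cgj) (deriveM rfj cgj) (deriveM cfj rgj).
rewrite cmapK; last exact: chart_at_dom.
move: ('D_ _ _ _) ('D_ _ _ _) ('D_ _ _ _) ('D_ _ _ _) => a1 a2 a3 a4.
case: (f p) (g p) => a b [c d]; apply/eqP; rewrite eq_complex /=.
rewrite /GRing.scale /=.
by apply/andP; split; apply/eqP; ring.
Qed.

End SmoothComplex.

Section Courant.
Variables (R : realType) (T : topologicalType) (n : nat) (A : manifold R T n).

(* Extension by zero; only its germs at points of the open set [U] are used. *)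
Definition ext (V : nmodType) (U : set T) (f : U -> V) (p : T) : V :=
  oapp f 0 (insub p).

Variables (E : cfibers R T n) (U : opens T).
Implicit Types (f g : U -> R[i]) (X Y : U -> 'rV[R[i]]_n).

Definition smooth_section f X : Prop := forall p : U,
  csmooth_map_at A (ext f) (val p) /\ csmooth_field_at A (ext X) (val p).

(* [df + X] lies in the conjugate of [E] iff its conjugate lies in [E]. *)
Definition in_courant f X : Prop :=
  smooth_section f X /\
  forall p : U,
    E (val p) (map_mx conjc (row_mx (X p) (dfun A (ext f) (val p)))).

Definition admissible f : Prop := exists X, in_courant f X.

Record courant := Courant {
  cou_fun : U -> R[i];
  cou_field : U -> 'rV[R[i]]_n;
  couP : in_courant cou_fun cou_field }.

Lemma courant_eq (s t : courant) :
  cou_fun s =1 cou_fun t -> cou_field s =1 cou_field t -> s = t.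
Proof.
case: s t => [f X s] [g Y t] /= /funext fg /funext XY.
by case: g / fg t; case: Y / XY => t; congr Courant; exact: Prop_irrelevance.
Qed.

Lemma ext_val (V : nmodType) (f : U -> V) (p : U) : ext f (val p) = f p.
Proof. by rewrite /ext valK. Qed.

Lemma extD (V : nmodType) (f g : U -> V) :
  ext (fun p => f p + g p) = (fun p => ext f p + ext g p).
Proof.
by apply/funext => p; rewrite /ext; case: insubP => //= _; rewrite addr0.
Qed.

Lemma extZ f X : ext (fun p => f p *: X p) = (fun p => ext f p *: ext X p).
Proof.
by apply/funext => p; rewrite /ext; case: insubP => //= _; rewrite scaler0.
Qed.

Lemma extM f g : ext (fun p => f p * g p) = (fun p => ext f p * ext g p).
Proof.
by apply/funext => p; rewrite /ext; case: insubP => //= _; rewrite mulr0.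
Qed.

Lemma ext0 (V : nmodType) : ext (fun _ : U => 0 : V) = (fun=> 0).
Proof. by apply/funext => p; rewrite /ext; case: insubP. Qed.

Lemma ext_cst (V : nmodType) (a : V) (p : U) :
  \forall q \near val p, a = ext (fun _ : U => a) q.
Proof.
have Up : oset U (val p) by have := valP p; rewrite inE.
apply: filterS (open_nbhs_nbhs (conj (oset_open U) Up)) => q Uq.
by rewrite /ext insubT ?inE.
Qed.

Lemma cfib_comb p (a b : R[i]) (e e' : 'rV_(n + n)) :
  E p (map_mx conjc e) -> E p (map_mx conjc e') ->
  E p (map_mx conjc (a *: e + b *: e')).
Proof.
move=> he he'; rewrite map_mxD !map_mxZ.
by apply: cfib_lin => //; rewrite -[_ *: _]addr0; apply: cfib_lin => //; exact: cfib0.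
Qed.

Lemma courant_cst (a : R[i]) : in_courant (fun=> a) (fun=> 0).
Proof.
split=> p; have ea := ext_cst a p.
  split; first exact: csmooth_near ea (csmooth_cst _ _ _).
  by rewrite ext0; exact: csmooth_field_cst0.
by rewrite -(dfun_near _ ea) dfun_cst row_mx0 map_mx0; exact: cfib0.
Qed.

Lemma courantD f g X Y : in_courant f X -> in_courant g Y ->
  in_courant (fun p => f p + g p) (fun p => X p + Y p).
Proof.
move=> [sfX EX] [sgY EY]; split=> p;
  have [sf sX] := sfX p; have [sg sY] := sgY p.
  by rewrite !extD; split; [exact: csmoothD | exact: csmooth_fieldD].
rewrite extD dfunD// -add_row_mx.
by rewrite -[row_mx (X p) _]scale1r -[row_mx (Y p) _]scale1r; exact: cfib_comb.
Qed.

Lemma courantM f g X Y : in_courant f X -> in_courant g Y ->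
  in_courant (fun p => f p * g p) (fun p => f p *: Y p + g p *: X p).
Proof.
move=> [sfX EX] [sgY EY]; split=> p;
  have [sf sX] := sfX p; have [sg sY] := sgY p.
  rewrite extM extD !extZ; split; first exact: csmoothM.
  by apply: csmooth_fieldD; exact: csmooth_fieldZ.
by rewrite extM dfunM// !ext_val -add_row_mx -!scale_row_mx; exact: cfib_comb.
Qed.

Lemma courantN f X : in_courant f X ->
  in_courant (fun p => - f p) (fun p => - X p).
Proof.
move=> fX; have := courantM (courant_cst (- 1)) fX.
by under eq_fun do rewrite mulN1r;
   under [X in in_courant _ X]eq_fun do rewrite scaleN1r scaler0 addr0.
Qed.

HB.instance Definition _ := gen_eqMixin courant.
HB.instance Definition _ := gen_choiceMixin courant.

Definition cou_zero := Courant (courant_cst 0).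
Definition cou_one := Courant (courant_cst 1).
Definition cou_opp (s : courant) := Courant (courantN (couP s)).
Definition cou_add (s t : courant) := Courant (courantD (couP s) (couP t)).
Definition cou_mul (s t : courant) := Courant (courantM (couP s) (couP t)).

Fact cou_addA : associative cou_add.
Proof. by move=> s t u; apply: courant_eq => p /=; rewrite addrA. Qed.
Fact cou_addC : commutative cou_add.
Proof. by move=> s t; apply: courant_eq => p /=; rewrite addrC. Qed.
Fact cou_add0 : left_id cou_zero cou_add.
Proof. by move=> s; apply: courant_eq => p /=; rewrite add0r. Qed.
Fact cou_addN : left_inverse cou_zero cou_opp cou_add.
Proof. by move=> s; apply: courant_eq => p /=; rewrite addNr. Qed.

HB.instance Definition _ :=
  GRing.isZmodule.Build courant cou_addA cou_addC cou_add0 cou_addN.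

Fact cou_mulA : associative cou_mul.
Proof.
move=> s t u; apply: courant_eq => p /=; first by rewrite mulrA.
rewrite !scalerDr !scalerA addrA; congr (_ + _ + _ *: _); last exact: mulrC.
by rewrite mulrC.
Qed.
Fact cou_mulC : commutative cou_mul.
Proof.
by move=> s t; apply: courant_eq => p /=; [rewrite mulrC | rewrite addrC].
Qed.
Fact cou_mul1 : left_id cou_one cou_mul.
Proof.
by move=> s; apply: courant_eq => p /=; rewrite ?mul1r// scale1r scaler0 addr0.
Qed.
Fact cou_mulD : left_distributive cou_mul +%R.
Proof.
move=> s t u; apply: courant_eq => p /=; first by rewrite mulrDl.
by rewrite scalerDl scalerDr addrACA.
Qed.

HB.instance Definition _ := GRing.Zmodule_isComPzRing.Build courant
  cou_mulA cou_mulC cou_mul1 cou_mulD.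

End Courant.

Section Split.
Variables (R : realType) (M : topologicalType) (m : nat) (AM : manifold R M m).
Variables (S : set M) (k : nat) (AS : manifold R S k).

Definition sub_incl (p : S) : M := val p.

(* T_pS, as the row space of the differential of the inclusion. *)
Definition tangent (p : S) : 'M[R]_(k, m) := dmap AS AM sub_incl p.

(* [S] carries the subspace topology, so this says that the inclusion is a
   smooth embedding. *)
Definition submanifold : Prop :=
  (forall (p : S) phi psi, atlas AS phi -> cdom phi p ->
     atlas AM psi -> cdom psi (sub_incl p) ->
     smooth_at (psi \o sub_incl \o cinv phi) (phi p)) /\
  (forall p : S, row_free (tangent p)).

Variables (J : gacs AM) (N : S -> 'M[R]_m).

(* [N p] stands for its row space, a subspace of T_pM. *)
Definition smooth_subbundle : Prop :=
  forall p : S, exists r (F : S -> 'M[R]_(r, m)),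
  (forall psi, atlas AM psi -> cdom psi (sub_incl p) ->
     smooth_map_at AS (fun q => F q *m dchart AM psi (sub_incl q)) p) /\
  \forall q \near p, row_free (F q) && (F q == N q)%MS.

Definition annihilates (a : nat) (B : 'M[R]_(a, m)) (xi : 'rV[R]_m) : Prop :=
  forall v : 'rV[R]_m, (v <= B)%MS -> ev xi v = 0.

Definition in_TS_AnnN (p : S) (e : 'rV[R]_(m + m)) : Prop :=
  (lsubmx e <= tangent p)%MS /\ annihilates (N p) (rsubmx e).

Definition split_by : Prop :=
  [/\ smooth_subbundle,
      forall p, (tangent p + N p == 1%:M)%MS,
      forall p, (tangent p :&: N p)%MS = 0
    & forall p e, in_TS_AnnN p e -> in_TS_AnnN p (e *m J (sub_incl p))].

(* Restriction of covectors to T_pS is multiplication by the transpose of the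
   differential of the inclusion. *)
Definition induced_fib (p : S) : set 'rV[R[i]]_(k + k) :=
  [set e' | exists2 e, eigenbundle J (sub_incl p) e &
     lsubmx e = lsubmx e' *m cmx (tangent p) /\
     rsubmx e' = rsubmx e *m (cmx (tangent p))^T].

Lemma induced_fib0 p : induced_fib p 0.
Proof.
by exists 0; [exact: cfib0 | rewrite !linear0 !mul0mx].
Qed.

Lemma induced_fib_lin p (a : R[i]) e e' :
  induced_fib p e -> induced_fib p e' -> induced_fib p (a *: e + e').
Proof.
move=> [d Ed [dl dr]] [d' Ed' [dl' dr']]; exists (a *: d + d').
  exact: cfib_lin.
by rewrite !linearP /= dl dl' dr dr' !mulmxDl !scalemxAl.
Qed.

Definition induced_bundle : cfibers R S k := CFibers induced_fib0 induced_fib_lin.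

(* The projection T_pM -> T_pS parallel to [N p], in coordinates. *)
Definition tproj (p : S) : 'M[R[i]]_(m, k) :=
  proj_mx <<cmx (tangent p)>>%MS (cmx (N p)) *m pinvmx (cmx (tangent p)).

Variable U : opens M.

Lemma opens_trace_open : open (sub_incl @^-1` U).
Proof. by exists (U : set M); [exact: oset_open|]. Qed.

Definition opens_trace : opens S := Opens opens_trace_open.

Definition trace_incl (q : opens_trace) : U := exist _ (sub_incl (val q)) (valP q).

Definition restr_fun (f : U -> R[i]) (q : opens_trace) : R[i] :=
  f (trace_incl q).

Definition restr_field (X : U -> 'rV[R[i]]_m) (q : opens_trace)
    : 'rV[R[i]]_k :=
  X (trace_incl q) *m tproj (val q).

End Split.

(* Main.v *)
Require Import Defs.
From HB Require Import structures.
From mathcomp Require Import all_boot all_order all_algebra.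
From mathcomp Require Import complex.
From mathcomp Require Import all_classical all_reals all_analysis.

Set Implicit Arguments.
Unset Strict Implicit.
Unset Printing Implicit Defensive.

Import Order.TTheory GRing.Theory Num.Theory.
Import numFieldNormedType.Exports.
Local Open Scope classical_set_scope.
Local Open Scope ring_scope.

(* Let [P] be the projection of TM|_S onto TS parallel to N, and [Q] the
   endomorphism [X + xi |-> P X + xi o P] of (TM + T*M)|_S, that is, the
   projection onto TS + Ann N.  [Q] is self-adjoint for the pairing, while [J],
   being orthogonal of square -1, is anti-self-adjoint; hence the stability of
   TS + Ann N, which reads [Q J Q = Q J], also gives [Q J Q = J Q], so [Q]
   commutes with [J] and preserves the eigenbundle E and its conjugate.  If
   [X + df] lies in the latter, then so does [P X + df o P], which exhibits
   [P X + d(f|_S)] as an element of the conjugate of E_S, because [df] and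
   [df o P] agree on TS. *)

(** * Chain rule and smooth functions on R^n *)

Section Jacobian.
Variable R : realType.

Lemma eq_mulmx_row a b (A B : 'M[R]_(a, b)) :
  (forall v : 'rV_a, v *m A = v *m B) -> A = B.
Proof. by move=> AB; apply/row_matrixP => i; rewrite !rowE. Qed.

(** Jacobians act on row vectors from the right, so the factors stand in the order of
    application. *)
Lemma jacobian_comp a b c (f : 'rV[R]_a -> 'rV[R]_b) (g : 'rV[R]_b -> 'rV[R]_c)
    x : differentiable f x -> differentiable g (f x) ->
  'J (g \o f) x = 'J f x *m 'J g (f x).
Proof.
move=> df dg; have dgf := differentiable_comp df dg.
apply: eq_mulmx_row => v; rewrite mulmxA.
rewrite -(deriveEjacobian _ df) -(deriveEjacobian _ dg) -(deriveEjacobian _ dgf).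
by rewrite (deriveE _ df) (deriveE _ dg) (deriveE _ dgf) (diff_comp df dg).
Qed.

Lemma near_eq_jacobian a b (f g : 'rV[R]_a -> 'rV[R]_b) x :
  (\forall y \near x, f y = g y) -> differentiable f x -> 'J f x = 'J g x.
Proof.
move=> fg df; apply: eq_mulmx_row => v.
have dg := near_eq_differentiable fg df.
transitivity ('D_v f x); first exact/esym/deriveEjacobian.
transitivity ('D_v g x); last exact: deriveEjacobian.
exact: near_eq_derive.
Qed.

Lemma jacobian_id a (x : 'rV[R]_a) : 'J id x = 1%:M.
Proof.
apply: eq_mulmx_row => v; rewrite -deriveEjacobian//.
by rewrite derive_id mulmx1.
Qed.

(** Expanding in the partial derivatives of [f], which are again real-valued, lets the induction of
    [Ck_comp] close. *)
Lemma derive_comp_jacobian a b (h : 'rV[R]_a -> 'rV[R]_b) (f : 'rV[R]_b -> R)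
    (v x : 'rV[R]_a) : differentiable h x -> differentiable f (h x) ->
  'D_v (f \o h) x =
  \sum_j (v *m 'J h x) 0 j * 'D_(delta_mx 0 j) f (h x).
Proof.
move=> dh df; rewrite deriveE; last exact: differentiable_comp.
rewrite diff_comp//= -(deriveE _ dh) deriveEjacobian//.
rewrite {1}(row_sum_delta (v *m _)) linear_sum/=.
by apply: eq_bigr => j _; rewrite linearZ/= deriveE.
Qed.

End Jacobian.

Section SmoothCalculus.
Variables (R : realType) (n : nat).
Implicit Type x : 'rV[R]_n.

Lemma Ck_coord a b k (f : 'rV[R]_n -> 'M[R]_(a, b)) x i j :
  Ck k f x -> Ck k (fun y => f y i j) x.
Proof.
elim: k f => [|k IH] f /=.
  move=> cf; near=> y.
  have cfy : {for y, continuous f} by near: y.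
  exact: (continuous_comp cfy (@coord_continuous _ _ _ i j _)).
move=> [df Df]; split.
  near=> y; apply: (@differentiable_comp _ _ _ _ f (fun M => M i j)).
    by near: y.
  exact: differentiable_coord.
move=> v; apply: Ck_near (IH _ (Df v)); near=> y.
rewrite derive_mx ?mxE//; apply: diff_derivable; near: y.
exact: df.
Unshelve. all: by end_near. Qed.

Lemma Ck_sum (I : Type) (s : seq I) k (f : I -> 'rV[R]_n -> R) x :
  (forall i, Ck k (f i) x) -> Ck k (fun y => \sum_(i <- s) f i y) x.
Proof.
move=> sf; elim: s => [|i s IH].
  by under eq_fun do rewrite big_nil; exact: smooth_cst.
by under eq_fun do rewrite big_cons; exact: CkD.
Qed.

(** Induction on [k]: the chain rule writes a derivative of [f \o h] as a sum of products of a
    coordinate of ['D_v h] with a partial derivative of [f] composed with [h], and the induction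
    hypothesis applies to the latter. *)
Lemma Ck_comp a k (h : 'rV[R]_n -> 'rV[R]_a) (f : 'rV[R]_a -> R) x :
  Ck k h x -> Ck k f (h x) -> Ck k (f \o h) x.
Proof.
elim: k f => [|k IH] f.
  move=> /= ch cf; have chx := nbhs_singleton ch.
  near=> y.
  apply: continuous_comp; first by near: y.
  by near: y; exact: chx cf.
move=> sh sf; have [[dh Dh] [df Df]] := (sh, sf).
have dfh : \forall y \near x, differentiable f (h y).
  exact: (differentiable_continuous (nbhs_singleton dh)) df.
split; first by near=> y; apply: differentiable_comp; near: y.
move=> v; apply: (@Ck_near _ _ _ _
    (fun y => \sum_j ('D_v h y) 0 j * ('D_(delta_mx 0 j) f \o h) y)).
  near=> y; have dhy : differentiable h y by near: y.
  rewrite derive_comp_jacobian//; last by near: y.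
  by rewrite deriveEjacobian.
apply: Ck_sum => j; apply: CkM.
  exact: (@Ck_coord _ _ k (fun y => 'D_v h y) x 0 j (Dh v)).
by apply: IH; [exact: Ck_pred|exact: Df].
Unshelve. all: by end_near. Qed.

Lemma smooth_comp a (h : 'rV[R]_n -> 'rV[R]_a) (f : 'rV[R]_a -> R) x :
  smooth_at h x -> smooth_at f (h x) -> smooth_at (f \o h) x.
Proof. by move=> sh sf k; exact: Ck_comp. Qed.

Lemma smooth_coord a b (f : 'rV[R]_n -> 'M[R]_(a, b)) x i j :
  smooth_at f x -> smooth_at (fun y => f y i j) x.
Proof. by move=> sf k; exact: Ck_coord. Qed.

Lemma CkV k (f : 'rV[R]_n -> R) x :
  f x != 0 -> Ck k f x -> Ck k (fun y => (f y)^-1) x.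
Proof.
move=> fx0; elim: k => [|k IH].
  move=> /= cf; have cfx := nbhs_singleton cf.
  have f0 : \forall y \near x, f y != 0.
    exact: cfx (open_nbhs_nbhs (conj (@open_neq _ 0) fx0)).
  near=> y; have cfy : {for y, continuous f} by near: y.
  by apply: (cvgV _ cfy); near: y.
move=> sf; have [df Df] := sf; have sf' := Ck_pred sf.
have cfx := differentiable_continuous (nbhs_singleton df).
have f0 : \forall y \near x, f y != 0.
  exact: cfx (open_nbhs_nbhs (conj (@open_neq _ 0) fx0)).
split; first by near=> y; apply: differentiableV; near: y.
(* The derivative of an inverse is a product of [f^-1] twice and ['D_v f], so the induction
   hypothesis and [CkM] suffice. *)
move=> v; apply: (@Ck_near _ _ _ _
    (fun y => (-1) * ((f y)^-1 * ((f y)^-1 * 'D_v f y)))).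
  near=> y; rewrite deriveV; first last.
  - by apply: diff_derivable; near: y.
  - by near: y.
  by rewrite mulN1r /GRing.scale/= mulNr -exprVn expr2 mulrA.
apply: CkM; first exact: smooth_cst.
by apply: CkM; [exact: IH|apply: CkM; [exact: IH|exact: Df]].
Unshelve. all: by end_near. Qed.

Lemma smooth_jacobian a (f : 'rV[R]_n -> 'rV[R]_a) x i j :
  smooth_at f x -> smooth_at (fun y => 'J f y i j) x.
Proof.
move=> sf k; have [df Df] := sf k.+1.
apply: Ck_near (Ck_coord 0 j (Df (delta_mx 0 i))); near=> y.
have dfy : differentiable f y by near: y.
by rewrite (deriveEjacobian _ dfy) -rowE [LHS]mxE.
Unshelve. all: by end_near. Qed.

End SmoothCalculus.

(** * Smooth matrix-valued functions on a manifold *)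

Section MatrixFunctions.
Variables (R : realType) (T : topologicalType) (n : nat) (A : manifold R T n).
Implicit Type p : T.

(** In any other chart the local expression of [g] is the given one composed with a transition map,
    which is smooth. *)
Lemma smooth_map_chart (g : T -> R) (phi : chart R T n) p :
  atlas A phi -> cdom phi p -> smooth_at (g \o cinv phi) (phi p) ->
  smooth_map_at A g p.
Proof.
move=> aphi dp sg psi apsi dp' k.
have nd : \forall q \near p, cdom phi q.
  exact: open_nbhs_nbhs (conj (cdom_open phi) dp).
apply: (@Ck_near _ _ _ _ ((g \o cinv phi) \o (phi \o cinv psi))).
  have := cinv_near dp' nd; apply: filterS => x dx /=.
  by rewrite cmapK.
apply: Ck_comp; first exact: (atlas_compat apsi aphi dp' dp k).
by rewrite /= cmapK//; exact: sg.
Qed.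

Lemma smooth_map_sum (I : Type) (s : seq I) (f : I -> T -> R) p :
  (forall i, smooth_map_at A (f i) p) ->
  smooth_map_at A (fun q => \sum_(i <- s) f i q) p.
Proof.
move=> sf; elim: s => [|i s IH].
  by under eq_fun do rewrite big_nil; exact: smooth_map_cst.
by under eq_fun do rewrite big_cons; exact: smooth_mapD.
Qed.

Lemma smooth_map_prod (I : Type) (s : seq I) (f : I -> T -> R) p :
  (forall i, smooth_map_at A (f i) p) ->
  smooth_map_at A (fun q => \prod_(i <- s) f i q) p.
Proof.
move=> sf; elim: s => [|i s IH].
  by under eq_fun do rewrite big_nil; exact: smooth_map_cst.
by under eq_fun do rewrite big_cons; exact: smooth_mapM.
Qed.

Lemma smooth_mapV (f : T -> R) p :
  f p != 0 -> smooth_map_at A f p -> smooth_map_at A (fun q => (f q)^-1) p.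
Proof.
move=> f0 sf phi aphi dp k; apply: (@CkV _ _ k (f \o cinv phi)); last exact: sf.
by rewrite /= cmapK.
Qed.

(** Entrywise, so that products, determinants and adjugates reduce to real-valued functions. *)
Definition smooth_mx_at a b (B : T -> 'M[R]_(a, b)) p : Prop :=
  forall i j, smooth_map_at A (fun q => B q i j) p.

Lemma smooth_map_mx a b (B : T -> 'M[R]_(a, b)) p :
  smooth_map_at A B p -> smooth_mx_at B p.
Proof.
move=> sB i j phi aphi dp.
exact: (@smooth_coord _ _ _ _ (B \o cinv phi) _ i j (sB _ aphi dp)).
Qed.

Lemma smooth_mx_near a b (B C : T -> 'M[R]_(a, b)) p :
  (\forall q \near p, B q = C q) -> smooth_mx_at B p -> smooth_mx_at C p.
Proof.
move=> BC sB i j; apply: smooth_map_near (sB i j).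
by apply: filterS BC => q ->.
Qed.

Lemma smooth_mx_cst a b (B : 'M[R]_(a, b)) p : smooth_mx_at (fun=> B) p.
Proof. by move=> i j; exact: smooth_map_cst. Qed.

Lemma smooth_mulmx a b c (B : T -> 'M[R]_(a, b)) (C : T -> 'M[R]_(b, c)) p :
  smooth_mx_at B p -> smooth_mx_at C p ->
  smooth_mx_at (fun q => B q *m C q) p.
Proof.
move=> sB sC i j; under eq_fun do rewrite mxE.
by apply: smooth_map_sum => l; exact: smooth_mapM.
Qed.

Lemma smooth_col_mx a b c (B : T -> 'M[R]_(a, c)) (C : T -> 'M[R]_(b, c)) p :
  smooth_mx_at B p -> smooth_mx_at C p ->
  smooth_mx_at (fun q => col_mx (B q) (C q)) p.
Proof.
move=> sB sC i j; under eq_fun do rewrite mxE.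
by case: (fintype.split i) => l; [exact: sB|exact: sC].
Qed.

Lemma smooth_det a (B : T -> 'M[R]_a) p :
  smooth_mx_at B p -> smooth_map_at A (fun q => \det (B q)) p.
Proof.
move=> sB; apply: smooth_map_sum => s; apply: smooth_mapM.
  exact: smooth_map_cst.
by apply: smooth_map_prod => i; exact: sB.
Qed.

Lemma smooth_adj a (B : T -> 'M[R]_a) p :
  smooth_mx_at B p -> smooth_mx_at (fun q => \adj (B q)) p.
Proof.
move=> sB i j; under eq_fun do rewrite mxE.
apply: smooth_mapM; first exact: smooth_map_cst.
apply: smooth_det => i' j'; under eq_fun do rewrite !mxE.
exact: sB.
Qed.

(** Cramer's rule. Invertibility is asked near [p] because [invmx] returns a singular matrix
    unchanged. *)
Lemma smooth_invmx a (B : T -> 'M[R]_a) p :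
  (\forall q \near p, B q \in unitmx) -> smooth_mx_at B p ->
  smooth_mx_at (fun q => invmx (B q)) p.
Proof.
move=> uB sB; apply: (@smooth_mx_near _ _
    (fun q => (\det (B q))^-1 *: \adj (B q))).
  by apply: filterS uB => q uBq; rewrite /invmx uBq.
move=> i j; under eq_fun do rewrite mxE.
apply: smooth_mapM; last exact: smooth_adj.
apply: smooth_mapV; last exact: smooth_det.
by have := nbhs_singleton uB; rewrite unitmxE unitfE.
Qed.

(* Stated with the equation [a = b] because it is used with [a = k + r]. *)
Lemma smooth_mx_solve a b c (ab : a = b) (B : T -> 'M[R]_(a, b))
    (C : T -> 'M[R]_(b, c)) (D : T -> 'M[R]_(a, c)) p :
  (\forall q \near p, row_free (B q) /\ B q *m C q = D q) ->
  smooth_mx_at B p -> smooth_mx_at D p -> smooth_mx_at C p.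
Proof.
case: b / ab B C => B C BCD sB sD.
have uB : \forall q \near p, B q \in unitmx.
  by apply: filterS BCD => q [fB _]; rewrite -row_free_unit.
apply: (@smooth_mx_near _ _ (fun q => invmx (B q) *m D q)).
  apply: filterS2 BCD uB => q [_ <-] uBq.
  by rewrite mulKmx.
by apply: smooth_mulmx => //; exact: smooth_invmx.
Qed.

Lemma csmooth_real (f : T -> R) p :
  smooth_map_at A f p -> csmooth_map_at A (fun q => real_complex R (f q)) p.
Proof. by move=> sf; split => //; exact: smooth_map_cst. Qed.

Lemma csmooth_sum (I : Type) (s : seq I) (f : I -> T -> R[i]) p :
  (forall i, csmooth_map_at A (f i) p) ->
  csmooth_map_at A (fun q => \sum_(i <- s) f i q) p.
Proof.
move=> sf; elim: s => [|i s IH].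
  by under eq_fun do rewrite big_nil; exact: csmooth_cst.
by under eq_fun do rewrite big_cons; exact: csmoothD.
Qed.

(** The two transition maps between [phi] and the preferred chart are mutually inverse near the
    point, so their Jacobians are too. *)
Lemma dchart_unit (phi : chart R T n) p :
  atlas A phi -> cdom phi p -> dchart A phi p \in unitmx.
Proof.
move=> aphi dp; have ap := chart_at_atlas A p; have dp' := chart_at_dom A p.
set psi := chart_at A p in ap dp' *.
have d1 := smooth_differentiable (atlas_compat ap aphi dp' dp).
have d2 := smooth_differentiable (atlas_compat aphi ap dp dp').
have e : (phi \o cinv psi) (psi p) = phi p by rewrite /= cmapK.
have d2' : differentiable (psi \o cinv phi) ((phi \o cinv psi) (psi p)).
  by rewrite e.
suff e1 : dchart A phi p *m
    'J (psi \o cinv phi) ((phi \o cinv psi) (psi p)) = 1%:M.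
  by case: (mulmx1_unit e1) => u1 _; exact: u1.
transitivity ('J ((psi \o cinv phi) \o (phi \o cinv psi)) (psi p)).
  exact/esym/jacobian_comp.
rewrite -(jacobian_id (psi p)).
apply: near_eq_jacobian; last exact: differentiable_comp d1 d2'.
have nd : \forall x \near psi p, cdom phi (cinv psi x).
  apply: cinv_near => //.
  exact: open_nbhs_nbhs (conj (cdom_open phi) dp).
have nc : \forall x \near psi p, ccod psi x.
  by apply: open_nbhs_nbhs; split; [exact: ccod_open|exact: cmap_cod].
by near=> x; rewrite /= cmapK ?cinvK//; near: x.
Unshelve. all: by end_near. Qed.

End MatrixFunctions.

(** * Restriction to a submanifold *)

Section Submanifold.
Variables (R : realType) (M : topologicalType) (m : nat) (AM : manifold R M m).
Variables (S : set M) (k : nat) (AS : manifold R S k).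
Hypothesis HS : submanifold AM AS.
Implicit Type p q : S.
Local Notation incl := (@sub_incl M S).
Local Notation tangent := (tangent AM AS).

Lemma sub_incl_continuous : continuous incl.
Proof. by apply/continuousP => V oV; exists V. Qed.

Lemma near_cdom_incl (psi : chart R M m) p :
  cdom psi (incl p) -> \forall q \near p, cdom psi (incl q).
Proof.
move=> dp; apply: (@sub_incl_continuous p).
exact: open_nbhs_nbhs (conj (cdom_open psi) dp).
Qed.

Lemma near_cdom (phi : chart R S k) p :
  cdom phi p -> \forall q \near p, cdom phi q.
Proof. by move=> dp; exact: open_nbhs_nbhs (conj (cdom_open phi) dp). Qed.

Lemma smooth_restr (g : M -> R) p :
  smooth_map_at AM g (incl p) -> smooth_map_at AS (g \o incl) p.
Proof.
move=> sg phi aphi dp l; pose psi := chart_at AM (incl p).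
have apsi : atlas AM psi := chart_at_atlas _ _.
have dpsi : cdom psi (incl p) := chart_at_dom _ _.
apply: (@Ck_near _ _ _ _ ((g \o cinv psi) \o (psi \o incl \o cinv phi))).
  have := cinv_near dp (near_cdom_incl dpsi); apply: filterS => x dx /=.
  by rewrite cmapK.
apply: Ck_comp; first exact: (HS.1 p phi psi aphi dp apsi dpsi l).
by rewrite /= cmapK//; exact: sg.
Qed.

Lemma csmooth_restr (f : M -> R[i]) p :
  csmooth_map_at AM f (incl p) -> csmooth_map_at AS (f \o incl) p.
Proof.
move=> [rf cf]; split; first exact: (smooth_restr rf).
exact: (smooth_restr cf).
Qed.

(** Both sides are the Jacobian of the inclusion read from the preferred chart of [S] to [psi],
    factored once through [phi] and once through the preferred chart of [M]. *)
Lemma tangent_chart (phi : chart R S k) (psi : chart R M m) p :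
  atlas AS phi -> cdom phi p -> atlas AM psi -> cdom psi (incl p) ->
  dchart AS phi p *m 'J (psi \o incl \o cinv phi) (phi p) =
  tangent p *m dchart AM psi (incl p).
Proof.
move=> aphi dp apsi dpsi.
rewrite /dchart /Defs.tangent /dmap.
have aphi0 : atlas AS (chart_at AS p) := chart_at_atlas _ _.
have dp0 : cdom (chart_at AS p) p := chart_at_dom _ _.
have apsi0 : atlas AM (chart_at AM (incl p)) := chart_at_atlas _ _.
have dpsi0 : cdom (chart_at AM (incl p)) (incl p) := chart_at_dom _ _.
move: aphi0 dp0 apsi0 dpsi0.
move: (chart_at AS p) (chart_at AM (incl p)) => phi0 psi0 aphi0 dp0 apsi0 dpsi0.
have d1 := smooth_differentiable (atlas_compat aphi0 aphi dp0 dp).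
have d2 : differentiable (psi \o incl \o cinv phi) ((phi \o cinv phi0) (phi0 p)).
  rewrite /= cmapK//.
  exact: smooth_differentiable (HS.1 p phi psi aphi dp apsi dpsi).
have d3 := smooth_differentiable (HS.1 p phi0 psi0 aphi0 dp0 apsi0 dpsi0).
have d4 : differentiable (psi \o cinv psi0) ((psi0 \o incl \o cinv phi0) (phi0 p)).
  rewrite /= cmapK//.
  exact: smooth_differentiable (atlas_compat apsi0 apsi dpsi0 dpsi).
transitivity ('J ((psi \o incl \o cinv phi) \o (phi \o cinv phi0)) (phi0 p)).
  rewrite (jacobian_comp d1 d2); congr (_ *m 'J _ _).
  by rewrite /= cmapK.
transitivity ('J ((psi \o cinv psi0) \o (psi0 \o incl \o cinv phi0)) (phi0 p)).
  apply: near_eq_jacobian; last exact: differentiable_comp d1 d2.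
  have n1 := cinv_near dp0 (near_cdom dp).
  have n2 := cinv_near dp0 (near_cdom_incl dpsi0).
  apply: filterS2 n1 n2 => x x1 x2 /=.
  by rewrite cmapK// cmapK.
rewrite (jacobian_comp d3 d4); congr (_ *m 'J _ _).
by rewrite /= cmapK.
Qed.

Lemma derive_restr (g : M -> R) p j : smooth_map_at AM g (incl p) ->
  'D_(delta_mx 0 j) (g \o incl \o cinv (chart_at AS p)) (chart_at AS p p) =
  \sum_l tangent p j l * 'D_(delta_mx 0 l) (g \o cinv (chart_at AM (incl p)))
                            (chart_at AM (incl p) (incl p)).
Proof.
move=> sg; rewrite /Defs.tangent /dmap.
have aphi : atlas AS (chart_at AS p) := chart_at_atlas _ _.
have dp : cdom (chart_at AS p) p := chart_at_dom _ _.
have apsi : atlas AM (chart_at AM (incl p)) := chart_at_atlas _ _.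
have dpsi : cdom (chart_at AM (incl p)) (incl p) := chart_at_dom _ _.
move: aphi dp apsi dpsi.
move: (chart_at AS p) (chart_at AM (incl p)) => phi psi aphi dp apsi dpsi.
have d1 := smooth_differentiable (HS.1 p phi psi aphi dp apsi dpsi).
have e : (psi \o incl \o cinv phi) (phi p) = psi (incl p) by rewrite /= cmapK.
have d2 : differentiable (g \o cinv psi) ((psi \o incl \o cinv phi) (phi p)).
  by rewrite e; exact: smooth_differentiable (sg _ apsi dpsi).
transitivity ('D_(delta_mx 0 j)
    ((g \o cinv psi) \o (psi \o incl \o cinv phi)) (phi p)).
  apply: near_eq_derive.
  have := cinv_near dp (near_cdom_incl dpsi); apply: filterS => x dx /=.
  by rewrite cmapK.
rewrite (derive_comp_jacobian _ d1 d2) e.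
by apply: eq_bigr => l _; rewrite -rowE mxE.
Qed.

(** The chain rule for the real and the imaginary part; they do not mix because [tangent p] is
    real. *)
Lemma dfun_restr (f : M -> R[i]) p : csmooth_map_at AM f (incl p) ->
  dfun AS (f \o incl) p = dfun AM f (incl p) *m (cmx (tangent p))^T.
Proof.
move=> [rf cf]; apply/rowP => j; rewrite !mxE.
rewrite (derive_restr j rf) (derive_restr j cf).
apply/eqP; rewrite eq_complex/= !raddf_sum/=.
by apply/andP; split; apply/eqP/eq_bigr => l _;
  rewrite !mxE/= mulr0 ?subr0 ?add0r mulrC.
Qed.

End Submanifold.

(** * Projections and the pairing *)

Section ProjectionMatrix.
Variables (F : fieldType) (a b : nat) (B : 'M[F]_(a, b)) (C : 'M[F]_b).

(** The projection onto the rows of [B] parallel to [C], in coordinates with respect to these rows.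
    It is the shape of [tproj] over any field, so that the real and the complex projection can be
    compared. *)
Definition proj_coord : 'M[F]_(b, a) := proj_mx <<B>>%MS C *m pinvmx B.

Hypothesis BC0 : (B :&: C)%MS = 0.

Lemma cap_genmx0 : (<<B>> :&: C)%MS = 0.
Proof.
apply/eqP; rewrite -submx0 -BC0 sub_capmx capmxSr andbT.
by apply: (submx_trans (capmxSl _ _)); rewrite genmxE.
Qed.

Lemma proj_coord_id : row_free B -> B *m proj_coord = 1%:M.
Proof.
move=> fB; rewrite mulmxA proj_mx_id ?cap_genmx0 ?genmxE//.
exact: mulmxVp.
Qed.

Lemma proj_coord_eq0 c (D : 'M[F]_(c, b)) : (D <= C)%MS -> D *m proj_coord = 0.
Proof. by move=> DC; rewrite mulmxA proj_mx_0 ?cap_genmx0// mul0mx. Qed.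

Lemma proj_coordK : proj_coord *m B = proj_mx <<B>>%MS C.
Proof.
by rewrite mulmxKpV// -[proj_mx _ _]mul1mx -(genmxE B); exact: proj_mx_sub.
Qed.

Lemma sub_proj_coord c (D : 'M[F]_(c, b)) : (B + C == 1%:M)%MS ->
  (D - D *m proj_coord *m B <= C)%MS.
Proof.
move=> /andP[_ BC1]; rewrite -mulmxA proj_coordK proj_mx_compl_sub//.
apply: (submx_trans (submx1 D)); apply: (submx_trans BC1).
by rewrite addsmxS ?genmxE.
Qed.

(** The rows of [B] and [C] span the space, so values on them determine the map. This frees
    [proj_coord] from the choice of basis in [<<B>>]. *)
Lemma proj_coord_unique (D : 'M[F]_(b, a)) : row_free B ->
  (B + C == 1%:M)%MS -> B *m D = 1%:M -> C *m D = 0 -> D = proj_coord.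
Proof.
move=> fB /andP[_ /sub_addsmxP[[u v]/= e1]] BD CD.
apply/eqP; rewrite -subr_eq0 -[_ - _]mul1mx e1 mulmxDl -!mulmxA !mulmxBr.
by rewrite BD CD proj_coord_id// proj_coord_eq0// !subrr addr0.
Qed.

End ProjectionMatrix.

(* The hypotheses are needed: [<<B>>] is an arbitrary choice of basis, which
   [f] need not preserve. *)
Lemma map_proj_coord (F F' : fieldType) (f : {rmorphism F -> F'}) a b
    (B : 'M[F]_(a, b)) (C : 'M[F]_b) :
  row_free B -> (B + C == 1%:M)%MS -> (B :&: C)%MS = 0 ->
  map_mx f (proj_coord B C) = proj_coord (map_mx f B) (map_mx f C).
Proof.
move=> fB BC1 BC0; apply: proj_coord_unique.
- by apply/eqP; rewrite -submx0 -map_capmx BC0 map_mx0.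
- by rewrite row_free_map.
- by move: BC1; rewrite -!(map_submx f) !map_addsmx map_mx1.
- by rewrite -map_mxM proj_coord_id// map_mx1.
- by rewrite -map_mxM proj_coord_eq0// map_mx0.
Qed.

(** * Commutation of a self-adjoint projection with an orthogonal complex structure *)

Section SkewCommute.
Variables (R : realType) (m : nat).

Lemma eq_bilinear_mx a b (A B : 'M[R]_(a, b)) :
  (forall (u : 'rV[R]_a) (v : 'rV[R]_b), (u *m A *m v^T) 0 0 = (u *m B *m v^T) 0 0) ->
  A = B.
Proof.
move=> AB; apply/matrixP => i j.
by have := AB (delta_mx 0 i) (delta_mx 0 j); rewrite trmx_delta -!rowE -!colE !mxE.
Qed.

(** The Gram matrix of the pairing, up to the factor -1/2. *)
Definition swap_mx : 'M[R]_(m + m) := block_mx 0 1%:M 1%:M 0.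

Lemma swap_mxK : swap_mx *m swap_mx = 1%:M.
Proof.
rewrite mulmx_block !(mul0mx, mulmx0, mul1mx, addr0, add0r).
by rewrite -scalar_mx_block.
Qed.

Lemma pairingE (u v : 'rV[R]_(m + m)) :
  pairing u v = - 2^-1 * (u *m swap_mx *m v^T) 0 0.
Proof.
rewrite -[u in RHS]hsubmxK -[v in RHS]hsubmxK mul_row_block.
rewrite !(mulmx0, mulmx1, add0r, addr0) tr_row_mx mul_row_col.
rewrite [X in _ = _ * X]mxE /pairing /ev; congr (_ * (_ + _)).
by rewrite -[in RHS](trmxK (lsubmx u)) -trmx_mul [RHS]mxE.
Qed.

(** The map [X + xi |-> P X + xi o P]: on coordinate rows, composing a covector with [P] is
    multiplication by [P^T]. *)
Definition split_mx (P : 'M[R]_m) : 'M[R]_(m + m) := block_mx P 0 0 P^T.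

(* [split_mx P] is self-adjoint and [J] anti-self-adjoint for the pairing, so
   the adjoint of [Q J Q = Q J] reads [- Q J Q = - J Q]. *)
Lemma split_mx_commute (P : 'M[R]_m) (J : 'M[R]_(m + m)) :
  (forall u v, pairing (u *m J) (v *m J) = pairing u v) ->
  J *m J = - 1%:M ->
  split_mx P *m J *m split_mx P = split_mx P *m J ->
  split_mx P *m J = J *m split_mx P.
Proof.
move=> orthJ sqJ; set Q := split_mx P; set G := swap_mx => stab.
have JGJ : J *m G *m J^T = G.
  apply: eq_bilinear_mx => u v; have := orthJ u v; rewrite !pairingE.
  have n2 : - 2^-1 != 0 :> R by rewrite oppr_eq0 invr_eq0 pnatr_eq0.
  by move=> /(mulfI n2) <-; rewrite trmx_mul !mulmxA.
have GJ : G *m J^T = - (J *m G).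
  by rewrite -[in RHS]JGJ !mulmxA sqJ !mulNmx mul1mx opprK.
have GQ : G *m Q^T = Q *m G.
  rewrite /G /Q /swap_mx /split_mx tr_block_mx !mulmx_block !trmx0 trmxK.
  by rewrite !(mul0mx, mulmx0, mul1mx, mulmx1, addr0, add0r).
(* Transpose the stability and move [G] rightwards through every factor: this gives
   [Q J Q G = J Q G] up to a common sign, and [G] cancels because its square is 1. *)
have /(congr1 (fun B => G *m B^T)) := stab; rewrite !trmx_mul !mulmxA.
rewrite GQ -(mulmxA Q) GJ !(mulmxN, mulNmx) => /oppr_inj; rewrite -!mulmxA GQ.
move=> /(congr1 (mulmx^~ G)); rewrite !mulmxA -!(mulmxA _ G G) swap_mxK.
by rewrite !mulmx1 stab.
Qed.

End SkewCommute.

(** * Split submanifolds *)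

Section SplitSubmanifold.
Variables (R : realType) (M : topologicalType) (m : nat) (AM : manifold R M m).
Variables (J : gacs AM) (S : set M) (k : nat) (AS : manifold R S k).
Variable N : S -> 'M[R]_m.
Hypotheses (HS : submanifold AM AS) (HN : split_by AS J N).
Implicit Type p q : S.
Local Notation incl := (@sub_incl M S).
Local Notation tangent := (tangent AM AS).

(* Locked, lest [mulmxA] reassociate the products inside [pinvmx]. *)
Definition real_proj p : 'M[R]_(m, k) := locked (proj_coord (tangent p) (N p)).

Lemma real_projE p : real_proj p = proj_coord (tangent p) (N p).
Proof. by rewrite /real_proj -lock. Qed.

Let fT p : row_free (tangent p) := HS.2 p.
Let TN1 p : (tangent p + N p == 1%:M)%MS.
Proof. by case: HN. Qed.
Let TN0 p : (tangent p :&: N p)%MS = 0.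
Proof. by case: HN. Qed.

(** The projection parallel to the complexified [N] comes from a real one, so smoothness and
    commutation with [J] can be settled over the reals. *)
Lemma tprojE p : tproj AM AS N p = cmx (real_proj p).
Proof. by rewrite real_projE /cmx map_proj_coord. Qed.

Lemma tangent_proj p : tangent p *m real_proj p = 1%:M.
Proof. by rewrite real_projE proj_coord_id. Qed.

Lemma real_proj_eq0 p c (D : 'M[R]_(c, m)) :
  (D <= N p)%MS -> D *m real_proj p = 0.
Proof. by rewrite real_projE; exact: proj_coord_eq0. Qed.

(** * Smoothness of the projection parallel to N *)

Lemma smooth_jacobian_chart (phi : chart R S k) (psi : chart R M m) p :
  atlas AS phi -> cdom phi p -> atlas AM psi -> cdom psi (incl p) ->
  smooth_mx_at AS (fun q => 'J (psi \o incl \o cinv phi) (phi q)) p.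
Proof.
move=> aphi dp apsi dpsi i j; apply: (smooth_map_chart aphi dp) => l.
have sh := HS.1 p phi psi aphi dp apsi dpsi.
apply: Ck_near (smooth_jacobian i j sh l).
have nc : \forall x \near phi p, ccod phi x.
  by apply: open_nbhs_nbhs; split; [exact: ccod_open|exact: cmap_cod].
by apply: filterS nc => x cx /=; rewrite cinvK.
Qed.

(** In charts the projection solves a linear system: it is the identity on the rows of the Jacobian
    of the inclusion and zero on a local frame of [N]. These rows together form a smooth invertible
    matrix. *)
Lemma smooth_real_proj (phi : chart R S k) (psi : chart R M m) p :
  atlas AS phi -> cdom phi p -> atlas AM psi -> cdom psi (incl p) ->
  smooth_mx_at AS (fun q =>
    invmx (dchart AM psi (incl q)) *m real_proj q *m dchart AS phi q) p.
Proof.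
move=> aphi dp apsi dpsi; have [sN _ _ _] := HN.
have [r [F [sF FN]]] := sN p.
have [fF /eqmxP eF] := andP (nbhs_singleton FN).
(* The [r] frame vectors complete the [k] tangent vectors to a basis, so the stacked matrix is
   square. *)
have mkr : (k + r = m)%N.
  have := mxrank_disjoint_sum (TN0 p); rewrite (eqmxP (TN1 p)) mxrank1.
  by rewrite -eF (eqP fF) (eqP (fT p)).
apply: (@smooth_mx_solve _ _ _ _ _ _ _ mkr
  (fun q => col_mx ('J (psi \o incl \o cinv phi) (phi q))
                   (F q *m dchart AM psi (incl q)))
  _ (fun=> col_mx 1%:M 0)).
- have n1 := near_cdom dp; have n2 := near_cdom_incl dpsi.
  near=> q.
  have dq : cdom phi q by near: q.
  have dpsiq : cdom psi (incl q) by near: q.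
  have uphi := dchart_unit aphi dq; have upsi := dchart_unit apsi dpsiq.
  have /andP[fFq /eqmxP eFq] : row_free (F q) && (F q == N q)%MS by near: q.
  have eJ : 'J (psi \o incl \o cinv phi) (phi q) =
      invmx (dchart AS phi q) *m tangent q *m dchart AM psi (incl q).
    rewrite -mulmxA -(tangent_chart HS aphi dq apsi dpsiq).
    by rewrite mulKmx.
  rewrite eJ -mul_col_mx; split.
    (* Changes of chart are invertible and TS + N is the whole tangent space, so the stacked matrix
       has rank [m]. *)
    have full : row_full (invmx (dchart AS phi q)).
      by rewrite row_full_unit unitmx_inv.
    rewrite /row_free mxrankMfree ?row_free_unit// -addsmxE.
    rewrite (adds_eqmx (eqmxMfull _ full) eFq) (eqmxP (TN1 q)) mxrank1.
    by rewrite mkr.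
  rewrite !mulmxA mulmxK// !mul_col_mx.
  rewrite -(mulmxA _ (tangent q)) tangent_proj mulmx1 mulVmx//.
  by rewrite real_proj_eq0 ?mul0mx// eFq.
- apply: smooth_col_mx; first exact: smooth_jacobian_chart.
  by apply: smooth_map_mx; exact: sF.
- exact: smooth_mx_cst.
Unshelve. all: by end_near. Qed.

Lemma csmooth_field_restr (X : M -> 'rV[R[i]]_m) p :
  csmooth_field_at AM X (incl p) ->
  csmooth_field_at AS (fun q => X (incl q) *m tproj AM AS N q) p.
Proof.
move=> sX phi aphi dp j; pose psi := chart_at AM (incl p).
have apsi : atlas AM psi := chart_at_atlas _ _.
have dpsi : cdom psi (incl p) := chart_at_dom _ _.
pose C q := invmx (dchart AM psi (incl q)) *m real_proj q *m dchart AS phi q.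
(* Inserting [dchart] and its inverse splits the expression into the coordinates of [X] in [psi] and
   the matrix of [smooth_real_proj]. *)
apply: (@csmooth_near _ _ _ _ (fun q =>
  ((X (incl q) *m cmx (dchart AM psi (incl q))) *m cmx (C q)) 0 j)).
  apply: filterS (near_cdom_incl dpsi) => q dq.
  rewrite tprojE -!mulmxA; congr ((_ *m _) 0 j).
  by rewrite /cmx -!map_mxM/= /C !mulmxA mulmxV ?mul1mx// dchart_unit.
under eq_fun do rewrite mxE.
apply: csmooth_sum => l; apply: csmoothM.
  exact: (csmooth_restr HS (sX psi apsi dpsi l)).
under eq_fun do rewrite mxE.
apply: csmooth_real; exact: (smooth_real_proj aphi dp apsi dpsi l j).
Qed.

(** The operator [Q] at [p]; [real_proj p *m tangent p] is [P] as an endomorphism of T_pM. *)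
Definition split_proj p : 'M[R]_(m + m) := split_mx (real_proj p *m tangent p).

(** The image of [P] is spanned by tangent rows, and a covector composed with [P] kills [N] because
    [P] does. *)
Lemma in_TS_AnnN_proj p (u : 'rV[R]_(m + m)) :
  in_TS_AnnN AM AS N p (u *m split_proj p).
Proof.
rewrite /in_TS_AnnN -[u]hsubmxK mul_row_block !(mulmx0, addr0, add0r).
rewrite row_mxKl row_mxKr; split; first by rewrite mulmxA submxMl.
move=> v vN; rewrite /ev -mulmxA -trmx_mul.
by rewrite mulmxA real_proj_eq0// mul0mx trmx0 mulmx0 mxE.
Qed.

Lemma in_TS_AnnN_fixed p (e : 'rV[R]_(m + m)) :
  in_TS_AnnN AM AS N p e -> e *m split_proj p = e.
Proof.
move=> [/submxP[w eT] eN]; rewrite -[e in LHS]hsubmxK mul_row_block.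
rewrite !(mulmx0, addr0, add0r) -[RHS]hsubmxK; congr row_mx.
  by rewrite eT !mulmxA -(mulmxA w) tangent_proj mulmx1.
(* Test the covector [xi] on an arbitrary [v]: the difference of both sides is, up to sign, the
   value of [xi] at [v - P v], which lies in [N]. *)
apply: (can_inj (@trmxK _ _ _)); apply: eq_mulmx_row => v.
rewrite trmx_mul trmxK; apply/eqP; rewrite -subr_eq0 mulmxA -mulmxBl.
rewrite -oppr_eq0 -mulNmx opprB; apply/eqP; apply: (can_inj (@trmxK _ _ _)).
rewrite trmx0 trmx_mul trmxK; apply/matrixP => i j; rewrite !ord1 [RHS]mxE.
by apply: eN; rewrite mulmxA real_projE; exact: sub_proj_coord.
Qed.

Lemma split_proj_commute p :
  split_proj p *m J (incl p) = J (incl p) *m split_proj p.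
Proof.
apply: split_mx_commute; [exact: gJ_orth|exact: gJ_sq|].
(* For each [u], the vector [u Q] lies in TS + Ann N, hence so does [u Q J], which [Q] therefore
   fixes. *)
apply: eq_mulmx_row => u; rewrite !mulmxA; apply: in_TS_AnnN_fixed.
by case: HN => _ _ _; apply; exact: in_TS_AnnN_proj.
Qed.

(** The witness is the image of [X + xi] under [Q]: it stays in the eigenbundle by commutation, its
    vector part is tangent to [S], and its covector part agrees with [xi] on TS since [P] is the
    identity there. *)
Lemma induced_fib_proj p (X xi : 'rV[R[i]]_m) :
  eigenbundle J (incl p) (row_mx X xi) ->
  induced_bundle AS J p
    (row_mx (X *m tproj AM AS N p) (xi *m (cmx (tangent p))^T)).
Proof.
rewrite /= /eigen_fib /= => eX; exists (row_mx X xi *m cmx (split_proj p)).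
  rewrite /= /eigen_fib /= -mulmxA -map_mxM split_proj_commute.
  by rewrite map_mxM mulmxA eX scalemxAl.
rewrite /cmx map_block_mx !map_mx0 mul_row_block !(mulmx0, addr0, add0r).
rewrite !row_mxKl !row_mxKr tprojE; split; first by rewrite -mulmxA -map_mxM.
rewrite -map_trmx -mulmxA -trmx_mul -map_mxM mulmxA.
by rewrite tangent_proj mul1mx.
Qed.

(** * Restriction of sections and the ring homomorphism *)

Variable U : opens M.
Local Notation V := (opens_trace S U).

(** The trace of [U] is its full preimage, so the two extensions by zero agree at every point and
    the results on composition with the inclusion apply. *)
Lemma ext_restr_fun (W : nmodType) (f : U -> W) q :
  ext (fun q : V => f (trace_incl q)) q = ext f (incl q).
Proof.
have VU : (q \in oset V) = (incl q \in oset U) by apply/idP/idP; rewrite !inE.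
rewrite /ext; case: insubP => [v vq ev|/negPf vq];
  case: insubP => [w wq ew|/negPf wq] //=.
- by congr f; apply: val_inj; rewrite /= ew -ev.
- by rewrite -VU vq in wq.
- by rewrite VU wq in vq.
Qed.

Lemma ext_restr_field (X : U -> 'rV[R[i]]_m) q :
  ext (restr_field AM AS N X) q = ext X (incl q) *m tproj AM AS N q.
Proof.
rewrite -ext_restr_fun /ext; case: insubP => [v _ <-|_] //=.
by rewrite mul0mx.
Qed.

Lemma smooth_section_restr (f : U -> R[i]) (X : U -> 'rV[R[i]]_m) :
  smooth_section AM f X ->
  smooth_section AS (U := V) (restr_fun f) (restr_field AM AS N X).
Proof.
move=> sfX p; have [sf sX] := sfX (trace_incl p).
rewrite (funext (ext_restr_fun f)) (funext (ext_restr_field X)); split.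
  exact: (csmooth_restr HS sf).
exact: (csmooth_field_restr sX).
Qed.

Lemma in_courant_restr (f : U -> R[i]) (X : U -> 'rV[R[i]]_m) :
  in_courant AM (eigenbundle J) f X ->
  in_courant AS (induced_bundle AS J) (U := V)
    (restr_fun f) (restr_field AM AS N X).
Proof.
move=> [sfX EX]; split; first exact: smooth_section_restr.
move=> p; have [sf _] := sfX (trace_incl p).
rewrite (funext (ext_restr_fun f)) (dfun_restr HS sf).
have cmxK a b (B : 'M[R]_(a, b)) : map_mx conjc (cmx B) = cmx B.
  by apply/matrixP => i j; rewrite !mxE /= oppr0.
(* The projection and the inclusion are real, so the conjugation in [in_courant] falls only on [X]
   and [df]. *)
have -> : map_mx conjc (row_mx (restr_field AM AS N X p)
      (dfun AM (ext f) (incl (val p)) *m (cmx (tangent (val p)))^T)) =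
    row_mx (map_mx conjc (X (trace_incl p)) *m tproj AM AS N (val p))
      (map_mx conjc (dfun AM (ext f) (incl (val p))) *m (cmx (tangent (val p)))^T).
  rewrite map_row_mx /restr_field tprojE; congr row_mx; rewrite map_mxM.
    by rewrite cmxK.
  by rewrite map_trmx cmxK.
by apply: induced_fib_proj; rewrite -map_row_mx; exact: EX (trace_incl p).
Qed.

Definition courant_restr (s : courant AM (eigenbundle J) U) :
  courant AS (induced_bundle AS J) V := Courant (in_courant_restr (couP s)).

Fact courant_restr_zmod : zmod_morphism courant_restr.
Proof.
move=> s t; apply: courant_eq => p //=.
by rewrite /restr_field mulmxBl.
Qed.

Fact courant_restr_monoid : monoid_morphism courant_restr.
Proof.
split=> [|s t]; apply: courant_eq => p //=; rewrite /restr_field ?mul0mx//.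
by rewrite mulmxDl -!scalemxAl.
Qed.

HB.instance Definition _ := GRing.isZmodMorphism.Build _ _
  courant_restr courant_restr_zmod.
HB.instance Definition _ := GRing.isMonoidMorphism.Build _ _
  courant_restr courant_restr_monoid.

End SplitSubmanifold.

Theorem theorem5p11 (R : realType) (M : topologicalType) (m : nat)
    (AM : manifold R M m) (J : gacs AM)
    (S : set M) (k : nat) (AS : manifold R S k) (N : S -> 'M[R]_m)
    (HS : submanifold AM AS) (HN : split_by AS J N) (U : opens M) :
  [/\ forall (f : U -> R[i]) (X : U -> 'rV[R[i]]_m),
        smooth_section AM f X ->
        smooth_section AS (U := opens_trace S U)
          (restr_fun f) (restr_field AM AS N X),
      exists rho : {rmorphism courant AM (eigenbundle J) U ->
                              courant AS (induced_bundle AS J) (opens_trace S U)},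
        forall s, cou_fun (rho s) = restr_fun (cou_fun s) /\
                  cou_field (rho s) = restr_field AM AS N (cou_field s)
    & forall f : U -> R[i],
        admissible AM (eigenbundle J) f ->
        admissible AS (induced_bundle AS J) (U := opens_trace S U) (restr_fun f)].
Proof.
split; first exact: (smooth_section_restr HS HN).
- by exists (courant_restr HS HN (U := U)).
- by move=> f [X fX]; exists (restr_field AM AS N X); exact: in_courant_restr.
Qed.
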